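(* Suppose the standing assumptions (A1)–(A2) and the assumptions (B1)–(B3) of the context hold. For an arbitrary $R_0\in\mathcal{M}$, let $R_0,R_1,\dots$ be the iterates produced by the Riemannian semismooth Newton method described in the context. Let $\nu_{\max}=\frac{\gamma_2(\bar L_\Psi+\kappa_H)}{1-\eta_2}$ and $N=\theta+\nu_{\max}+\alpha L_\Psi+\alpha\kappa_\Psi M+\kappa_H$. Then for any $\epsilon>0$, the total number of successful iterations $l$ such that $\|\operatorname{grad}\Psi(R_l)\|_F>\epsilon$ is bounded above by $$K_1(\epsilon)=\frac{2(\Psi(R_0)-\Psi_{\mathrm{low}})}{\eta_1\nu_{\min}}\,N^2\,\frac{1}{\epsilon^2}.$$ Furthermore, $\lim_{l\to\infty}\|\operatorname{grad}\Psi(R_l)\|_F=0$.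
   Context: $\mathbb{S}^n$ is the space of real symmetric $n\times n$ matrices, $\langle A,B\rangle=\operatorname{tr}(A^TB)$, $\|\cdot\|_F$ is the Frobenius norm. Given are $A_1,\dots,A_m,B_1,\dots,B_{m_0}\in\mathbb{S}^n$, $b\in\mathbb{R}^m$, $b_0\in\mathbb{R}^{m_0}$; $\mathcal{A}(X)=(\operatorname{tr}(A_iX))_{i=1}^m$, $\mathcal{B}(X)=(\operatorname{tr}(B_iX))_{i=1}^{m_0}$, with adjoints $\mathcal{A}^*,\mathcal{B}^*$. Set $\mathcal{D}=\{X\in\mathbb{S}^n: X\succeq 0,\ \mathcal{B}(X)=b_0\}$ and, for a fixed positive integer $p$, $\mathcal{M}=\{R\in\mathbb{R}^{p\times n}:\mathcal{B}(R^TR)=b_0\}$. The underlying problem is $\min_{X\in\mathcal{D}} f(X)+h(X)$ subject to $\mathcal{A}(X)=b$. Standing assumptions. (A1) This problem has a low-rank optimal solution (no specific rank bound is prescribed) and its objective is bounded from below; $f:\mathbb{S}^n\to\mathbb{R}$ is convex and twice differentiable with Lipschitz continuous gradient; $h:\mathbb{S}^n\to\mathbb{R}\cup\{+\infty\}$ is convex, lower semicontinuous and proper. (A2) For every $X\in\mathcal{D}$ the matrices $B_1X,\dots,B_{m_0}X$ are linearly independent, and $\mathcal{M}$ is a compact embedded submanifold of $\mathbb{R}^{p\times n}$. Subproblem. Fix $y^k\in\mathbb{R}^m$, $Z^k\in\mathbb{S}^n$, $\sigma_k>0$. Let $h^*$ be the convex conjugate of $h$, $\operatorname{prox}_g(W)=\operatorname{argmin}_{V\in\mathbb{S}^n}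 g(V)+\frac12\|V-W\|_F^2$, $T(X)=\sigma_k^{-1}\operatorname{prox}_{\sigma_kh^*}(\sigma_kX-Z^k)$, and $$\Phi(X)=f(X)+h\big(X-Z^k/\sigma_k-T(X)\big)+\tfrac{\sigma_k}{2}\big(\|\mathcal{A}(X)-b-y^k/\sigma_k\|_2^2+\|T(X)\|_F^2\big),\qquad \Psi(R)=\Phi(R^TR).$$ $\Phi$ is continuously differentiable. $\Psi_{\mathrm{low}}$ is a finite lower bound of $\Psi$ on $\mathcal{M}$. Riemannian objects. $T_R\mathcal{M}=\{U\in\mathbb{R}^{p\times n}:\mathcal{B}(R^TU+U^TR)=0\}$, $P_{T_R\mathcal{M}}$ is the orthogonal projection onto it, $P^\perp_{T_R\mathcal{M}}=I-P_{T_R\mathcal{M}}$, and $\operatorname{grad}\Psi(R)=P_{T_R\mathcal{M}}(\nabla\Psi(R))$. $\partial T(X)$ is the Clarke differential of $T$ (convex hull of limits of derivatives at differentiability points). The generalized Riemannian Hessian $\operatorname{Hess}\Psi(R)$ is the set of operators $U\mapsto P_{T_R\mathcal{M}}(G[U])+\mathfrak{W}_R(U,P^\perp_{T_R\mathcal{M}}(\nabla\Psi(R)))$ on $T_R\mathcal{M}$, where $G[U]=2U\nabla\Phi(R^TR)+2R\,\mathcal{V}[R^TU+U^TR]$, $\mathcal{V}=\nabla^2f(R^TR)+\sigma_k\mathcal{A}^*\mathcal{A}+\sigma_k\Theta$ with $\Theta\in\partial T(R^TR)$, and $\mathfrak{W}_R(U,V)=-P_{T_R\mathcal{M}}D_UV$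 for $V$ normal at $R$ ($D_UV$ the derivative at $R$ along $U$ of any extension of $V$ to a normal vector field on $\mathcal{M}$). $\mathcal{R}$ is a retraction on $\mathcal{M}$. Assumptions. (B1) There are $\kappa_\Psi,\kappa_H$ with $\|\nabla\Psi(R)\|_F\le\kappa_\Psi$ and $\|\operatorname{Hess}\Psi(R)[U]\|_F\le\kappa_H\|U\|_F$ (for every element of the generalized Hessian) for all $R\in\mathcal{M}$, $U\in T_R\mathcal{M}$. (B2) There are $\alpha,\beta>0$ with $\|\mathcal{R}_R(U)-R\|_F\le\alpha\|U\|_F$ and $\|\mathcal{R}_R(U)-R-U\|_F\le\beta\|U\|_F^2$ for all $R\in\mathcal{M}$, $U\in T_R\mathcal{M}$. (B3) There is a finite $M>0$ with $\|P_{T_R\mathcal{M}}(V)-P_{T_W\mathcal{M}}(V)\|_F\le M\|V\|_F\|U\|_F$ for all $R\in\mathcal{M}$, $U\in T_R\mathcal{M}$, $V\in\mathbb{R}^{p\times n}$, where $W=\mathcal{R}_R(U)$. Constants. $L_\Psi$ is a Lipschitz constant of $\nabla\Psi$ on $\mathcal{M}$. $\bar L_\Psi$ is a constant such that $\Psi(\mathcal{R}_R(U))\le\Psi(R)+\langle\operatorname{grad}\Psi(R),U\rangle+\frac{\bar L_\Psi}{2}\|U\|_F^2$ for all $R\in\mathcal{M}$, $U\in T_R\mathcal{M}$ (such constants exist). Algorithm. Parameters: $0<\eta_1\le\eta_2<1$, $0<\gamma_0<1<\gamma_1\le\gamma_2$, $\nu_{\min}>0$, $\theta\ge0$, $\mu>0$,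 and an initial regularization parameter $\nu_0>0$. At iteration $l$, with $\mathfrak{H}_l\in\operatorname{Hess}\Psi(R_l)$ and $$m_l(U)=\langle\operatorname{grad}\Psi(R_l),U\rangle+\tfrac12\langle\mathfrak{H}_l[U],U\rangle+\tfrac{\nu_l}{2}\|U\|_F^2,\quad U\in T_{R_l}\mathcal{M},$$ a step $U_l\in T_{R_l}\mathcal{M}$ (the line-search step size is absorbed into $U_l$) is computed satisfying $\|\nabla m_l(U_l)\|_F\le\theta\|U_l\|_F$, $m_l(U_l)\le0$, $\langle U_l,\operatorname{grad}\Psi(R_l)\rangle<0$ and the Armijo condition $m_l(U_l)\le\mu\langle\operatorname{grad}\Psi(R_l),U_l\rangle$. Put $\bar R_l=\mathcal{R}_{R_l}(U_l)$ and $\rho_l=\frac{\Psi(\bar R_l)-\Psi(R_l)}{m_l(U_l)-\frac{\nu_l}{2}\|U_l\|_F^2}$. If $\rho_l\ge\eta_1$ the iteration is successful and $R_{l+1}=\bar R_l$; otherwise $R_{l+1}=R_l$. Then $\nu_{l+1}\in[\max(\nu_{\min},\gamma_0\nu_l),\nu_l]$ if $\rho_l\ge\eta_2$; $\nu_{l+1}\in[\nu_l,\gamma_1\nu_l]$ if $\eta_1\le\rho_l<\eta_2$; $\nu_{l+1}\in[\gamma_1\nu_l,\gamma_2\nu_l]$ otherwise. The algorithm is run without an iteration limit.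
   Formalization: The bound K_1(ε) is proved only when ν_min ≤ ν_0 ≤ ν_max; for arbitrary ν_0>0 it is false (a huge ν_0 may be kept forever, and for ν_0<ν_min the update interval can be empty). The limit is proved for every ν_0>0. *)

(* Defs.v *)
From HB Require Import structures.
From mathcomp Require Import all_boot all_order all_algebra finmap.
From mathcomp Require Import all_classical all_reals all_analysis.
From mathcomp Require Import ring lra.

Set Implicit Arguments.
Unset Strict Implicit.
Unset Printing Implicit Defensive.

Import Order.TTheory GRing.Theory Num.Theory.
Import numFieldNormedType.Exports.

Local Open Scope classical_set_scope.
Local Open Scope ring_scope.

(** * Frobenius inner product and norm *)

(* The canonical norm of ['M[R]_(p, n)] is the max norm; it induces the same
   topology and the same derivatives, but the estimates are in [fnorm]. *)
Definition fdot {R : realType} {p n : nat} (A B : 'M[R]_(p, n)) : R :=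
  \tr (A^T *m B).

Definition fnorm {R : realType} {p n : nat} (A : 'M[R]_(p, n)) : R :=
  Num.sqrt (fdot A A).

Section FrobeniusTheory.
Context {R : realType} {p n : nat}.
Implicit Types A B C : 'M[R]_(p, n).

Lemma fdotE A B : fdot A B = \sum_i \sum_j A i j * B i j.
Proof.
rewrite /fdot /mxtrace exchange_big/=; apply: eq_bigr => j _.
by rewrite mxE; apply: eq_bigr => i _; rewrite mxE.
Qed.

Lemma fdotC A B : fdot A B = fdot B A.
Proof.
by rewrite !fdotE; apply: eq_bigr => i _; apply: eq_bigr => j _; rewrite mulrC.
Qed.

Lemma fdotDl A B C : fdot (A + B) C = fdot A C + fdot B C.
Proof. by rewrite /fdot linearD/= mulmxDl mxtraceD. Qed.

Lemma fdotZl (k : R) A B : fdot (k *: A) B = k * fdot A B.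
Proof. by rewrite /fdot linearZ/= -scalemxAl mxtraceZ. Qed.

Lemma fdotDr A B C : fdot A (B + C) = fdot A B + fdot A C.
Proof. by rewrite fdotC fdotDl !(fdotC A). Qed.

Lemma fdotZr (k : R) A B : fdot A (k *: B) = k * fdot A B.
Proof. by rewrite fdotC fdotZl fdotC. Qed.

Lemma fdot_ge0 A : 0 <= fdot A A.
Proof.
by rewrite fdotE; do 2![apply: sumr_ge0 => ? _]; rewrite -expr2 sqr_ge0.
Qed.

Lemma fdot_eq0 A : fdot A A = 0 -> A = 0.
Proof.
have sq0 (i : 'I_p) (j : 'I_n) : 0 <= A i j * A i j by rewrite -expr2 sqr_ge0.
rewrite fdotE => /eqP; rewrite psumr_eq0; last by move=> i _; apply: sumr_ge0.
move=> /allP A0; apply/matrixP => i j; rewrite mxE.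
have := A0 i (mem_index_enum i); rewrite /= psumr_eq0; last by [].
by move=> /allP /(_ j (mem_index_enum j)); rewrite /= mulf_eq0 orbb => /eqP.
Qed.

Lemma fnorm_ge0 A : 0 <= fnorm A.
Proof. exact: sqrtr_ge0. Qed.

Lemma sqr_fnorm A : fnorm A ^+ 2 = fdot A A.
Proof. by rewrite sqr_sqrtr ?fdot_ge0. Qed.

Lemma fnorm_eq0 A : fnorm A = 0 -> A = 0.
Proof. by move=> A0; apply: fdot_eq0; rewrite -sqr_fnorm A0 expr0n. Qed.

Lemma fnormZ (k : R) A : fnorm (k *: A) = `|k| * fnorm A.
Proof.
by rewrite /fnorm fdotZl fdotZr mulrA -expr2 sqrtrM ?sqr_ge0// sqrtr_sqr.
Qed.

Lemma fdot0l B : fdot (0 : 'M[R]_(p, n)) B = 0.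
Proof. by rewrite -(scale0r (0 : 'M[R]_(p, n))) fdotZl mul0r. Qed.

Lemma fdot_le A B : fdot A B <= fnorm A * fnorm B.
Proof.
have [A0|A0] := eqVneq (fnorm A) 0.
  by rewrite A0 mul0r (fnorm_eq0 A0) fdot0l.
have [B0|B0] := eqVneq (fnorm B) 0.
  by rewrite B0 mulr0 (fnorm_eq0 B0) fdotC fdot0l.
have Ap : 0 < fnorm A by rewrite lt_neqAle eq_sym A0 fnorm_ge0.
have Bp : 0 < fnorm B by rewrite lt_neqAle eq_sym B0 fnorm_ge0.
have := fdot_ge0 (fnorm B *: A + (- fnorm A) *: B).
rewrite !fdotDl !fdotDr !fdotZl !fdotZr (fdotC B A) -!sqr_fnorm.
have AB := mulr_gt0 Ap Bp.
set t := fdot A B => h; rewrite -(ler_pM2l AB); nra.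
Qed.

Lemma fnormD A B : fnorm (A + B) <= fnorm A + fnorm B.
Proof.
rewrite -(@ler_pXn2r _ 2)// ?nnegrE ?addr_ge0 ?fnorm_ge0//.
rewrite sqr_fnorm fdotDl !fdotDr (fdotC B A) -!sqr_fnorm.
by have := fdot_le A B; nra.
Qed.

End FrobeniusTheory.

(** * The Euclidean space of symmetric matrices *)

Definition symmetric {R : realType} {n : nat} : {pred 'M[R]_n} :=
  [pred A : 'M[R]_n | A^T == A].

Fact symmetric_submod_closed (R : realType) (n : nat) :
  submod_closed (@symmetric R n).
Proof.
split=> [|a A B]; first by rewrite inE trmx0.
by rewrite !inE linearD linearZ/= => /eqP -> /eqP ->.
Qed.

HB.instance Definition _ (R : realType) (n : nat) :=
  GRing.isSubmodClosed.Build R 'M[R]_n (@symmetric R n)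
    (symmetric_submod_closed R n).

Record symmx (R : realType) (n : nat) :=
  Symmx { symmx_val :> 'M[R]_n; symmxP : symmx_val \in symmetric }.

HB.instance Definition _ (R : realType) (n : nat) :=
  [isSub of symmx R n for @symmx_val R n].
HB.instance Definition _ (R : realType) (n : nat) :=
  [Choice of symmx R n by <:].
HB.instance Definition _ (R : realType) (n : nat) :=
  [SubChoice_isSubLmodule of symmx R n by <:].

Fact symmx_normD (R : realType) (n : nat) (X Y : symmx R n) :
  fnorm (symmx_val (X + Y)) <= fnorm (symmx_val X) + fnorm (symmx_val Y).
Proof. exact: fnormD. Qed.

Fact symmx_normZ (R : realType) (n : nat) (k : R) (X : symmx R n) :
  fnorm (symmx_val (k *: X)) = `|k| * fnorm (symmx_val X).
Proof. exact: fnormZ. Qed.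

Fact symmx_norm_eq0 (R : realType) (n : nat) (X : symmx R n) :
  fnorm (symmx_val X) = 0 -> X = 0.
Proof. by move=> /fnorm_eq0 X0; apply: val_inj. Qed.

(* The norm [`|X|] of [symmx R n] is the Frobenius norm. *)
HB.instance Definition _ (R : realType) (n : nat) :=
  Lmodule_isNormed.Build R (symmx R n)
    (@symmx_normD R n) (@symmx_normZ R n) (@symmx_norm_eq0 R n).


Section SymmetricProducts.
Context {R : realType} {p n : nat}.

Fact gram_subproof (x : 'M[R]_(p, n)) : x^T *m x \in symmetric.
Proof. by rewrite inE trmx_mul trmxK. Qed.

Definition gram (x : 'M[R]_(p, n)) : symmx R n := Symmx (gram_subproof x).

Fact dgram_subproof (x u : 'M[R]_(p, n)) : x^T *m u + u^T *m x \in symmetric.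
Proof. by rewrite inE linearD/= !trmx_mul !trmxK addrC. Qed.

(* derivative of [gram] at [x] along [u] *)
Definition dgram (x u : 'M[R]_(p, n)) : symmx R n :=
  Symmx (dgram_subproof x u).

End SymmetricProducts.

Definition opA {R : realType} {n k : nat} (A : 'I_k -> symmx R n)
    (X : symmx R n) : 'cV[R]_k :=
  \col_i \tr (A i *m X).

(* adjoint of [opA A] *)
Definition opA_adj {R : realType} {n k : nat} (A : 'I_k -> symmx R n)
    (v : 'cV[R]_k) : symmx R n :=
  \sum_(i < k) v i 0 *: A i.

Definition psd {R : realType} {n : nat} (X : symmx R n) : Prop :=
  forall v : 'cV[R]_n, 0 <= (v^T *m X *m v) 0 0.

(** * Calculus *)

(* The Riesz representative of ['d f x] for the inner product [dot]. *)
Definition gradient {R : realType} {V : normedModType R} (dot : V -> V -> R)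
    (f : V -> R) (x : V) : V :=
  xget 0 [set g | forall v, 'd f x v = dot g v].

Definition mgrad {R : realType} {p n : nat} (f : 'M[R]_(p, n) -> R) :=
  gradient fdot f.

Definition sgrad {R : realType} {n : nat} (f : symmx R n -> R) :=
  gradient (fun X Y : symmx R n => fdot X Y) f.

Fixpoint Ck {R : realType} {V W : normedModType R} (k : nat) (O : set V)
    (f : V -> W) : Prop :=
  match k with
  | 0 => forall x, O x -> {for x, continuous f}
  | k.+1 => (forall x, O x -> differentiable f x) /\
            (forall v, Ck k O (fun x => 'D_v f x))
  end.

Definition smooth {R : realType} {V W : normedModType R} (O : set V)
    (f : V -> W) : Prop := forall k, Ck k O f.

Definition Bdiff {R : realType} {V W : normedModType R} (f : V -> W) (x : V) :
    set {linear V -> W} :=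
  [set L | exists u : nat -> V, [/\ u @ \oo --> x,
     (forall k, differentiable f (u k)) &
     (forall v, (fun k => 'd f (u k) v) @ \oo --> L v)]].

Definition clarke {R : realType} {V W : normedModType R} (f : V -> W) (x : V) :
    set {linear V -> W} :=
  [set L | exists (N : nat) (c : 'I_N -> R) (Ls : 'I_N -> {linear V -> W}),
     [/\ (forall i, 0 <= c i), \sum_i c i = 1, (forall i, Bdiff f x (Ls i)) &
         (forall v, L v = \sum_i c i *: Ls i v)]].

(** * Convex analysis on symmetric matrices *)

Definition convex_ereal {R : realType} {n : nat} (h : symmx R n -> \bar R) :
    Prop :=
  forall (X Y : symmx R n) (t : R), 0 <= t <= 1 ->
    (h (t *: X + (1 - t) *: Y)%R <= t%:E * h X + (1 - t)%:E * h Y)%E.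

Definition proper {R : realType} {n : nat} (h : symmx R n -> \bar R) : Prop :=
  (forall X, (-oo < h X)%E) /\ (exists X, (h X < +oo)%E).

Definition conjugate {R : realType} {n : nat} (h : symmx R n -> \bar R)
    (Y : symmx R n) : \bar R :=
  ereal_sup [set ((fdot Y X)%:E - h X)%E | X in [set: symmx R n]].

Definition prox {R : realType} {n : nat} (g : symmx R n -> \bar R)
    (W : symmx R n) : symmx R n :=
  xget 0 [set V | forall V' : symmx R n,
    (g V + (2^-1 * `|V - W| ^+ 2)%:E <= g V' + (2^-1 * `|V' - W| ^+ 2)%:E)%E].

(** * The problem and the subproblem *)

Record problem (R : realType) (n m m0 : nat) := Problem {
  pf : symmx R n -> R;
  ph : symmx R n -> \bar R;
  pA : 'I_m -> symmx R n;
  pb : 'cV[R]_m;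
  pB : 'I_m0 -> symmx R n;
  pb0 : 'cV[R]_m0;
}.

Record multipliers (R : realType) (n m : nat) := Multipliers {
  my : 'cV[R]_m;
  mZ : symmx R n;
  msigma : R;
}.

Section Problem.
Context {R : realType} {n m m0 : nat} (P : problem R n m m0).

Definition setD : set (symmx R n) :=
  [set X | psd X /\ opA (pB P) X = pb0 P].

Definition setM {p : nat} : set 'M[R]_(p, n) :=
  [set x | opA (pB P) (gram x) = pb0 P].

Definition feasible (X : symmx R n) : Prop :=
  setD X /\ opA (pA P) X = pb P.

Definition objective (X : symmx R n) : \bar R := ((pf P X)%:E + ph P X)%E.

Definition optimal (X : symmx R n) : Prop :=
  [/\ feasible X, (objective X < +oo)%E &
      forall Y, feasible Y -> (objective X <= objective Y)%E].

Definition problem_assumption : Prop :=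
  [/\ (exists X, optimal X),
      (exists c : R, forall X, feasible X -> (c%:E <= objective X)%E),
      [/\ convex_function [set: convex_lmodType (symmx R n)] (pf P),
          (forall X, differentiable (pf P) X),
          (forall X, differentiable (sgrad (pf P)) X) &
          (exists L : R, L.-lipschitz (sgrad (pf P)))] &
      [/\ convex_ereal (ph P), lower_semicontinuous (ph P) & proper (ph P)]].

(* Locally the zero set of a smooth submersion onto R^k. *)
Definition embedded_submanifold {p : nat} (M : set 'M[R]_(p, n)) : Prop :=
  exists k : nat, forall x, M x ->
    exists (O : set 'M[R]_(p, n)) (F : 'M[R]_(p, n) -> 'cV[R]_k),
      [/\ open O /\ O x, smooth O F,
          (forall w, O w -> (M w <-> F w = 0)) &
          (forall c, exists v, 'd F x v = c)].

Definition manifold_assumption (p : nat) : Prop :=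
  [/\ (forall X, setD X ->
         free [seq (pB P i : 'M[R]_n) *m X | i <- enum 'I_m0]),
      compact (@setM p) & embedded_submanifold (@setM p)].

Definition tangent {p : nat} (x : 'M[R]_(p, n)) : set 'M[R]_(p, n) :=
  [set u | opA (pB P) (dgram x u) = 0].

(* orthogonal projection onto [tangent x] *)
Definition tproj {p : nat} (x v : 'M[R]_(p, n)) : 'M[R]_(p, n) :=
  xget 0 [set w | tangent x w /\ forall u, tangent x u -> fdot (v - w) u = 0].

Definition nproj {p : nat} (x v : 'M[R]_(p, n)) : 'M[R]_(p, n) :=
  v - tproj x v.

(* [r x u] is only meaningful for [x] in [setM p] and [u] in [tangent x];
   smoothness on the tangent bundle is smoothness of local extensions. *)
Definition retraction {p : nat}
    (r : 'M[R]_(p, n) -> 'M[R]_(p, n) -> 'M[R]_(p, n)) : Prop :=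
  [/\ (forall x u, setM x -> tangent x u -> setM (r x u)),
      (forall x u, setM x -> tangent x u ->
         exists (O : set ('M[R]_(p, n) * 'M[R]_(p, n)))
                (F : 'M[R]_(p, n) * 'M[R]_(p, n) -> 'M[R]_(p, n)),
           [/\ open O /\ O (x, u), smooth O F &
               forall x' u', O (x', u') -> setM x' -> tangent x' u' ->
                 r x' u' = F (x', u')]),
      (forall x, setM x -> r x 0 = x) &
      (forall x u, setM x -> tangent x u ->
         is_derive (0 : R) 1 (fun t : R => r x (t *: u)) u)].

Definition normal_extension {p : nat} (x v : 'M[R]_(p, n))
    (E : 'M[R]_(p, n) -> 'M[R]_(p, n)) : Prop :=
  [/\ (exists O, [/\ open O, setM `<=` O & smooth O E]),
      (forall w u, setM w -> tangent w u -> fdot (E w) u = 0) &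
      E x = v].

(* [W] is the operator mapping [u] to the Weingarten map at [(u, v)]; only its
   values on [tangent x] matter, and they do not depend on the extension. *)
Definition weingarten {p : nat} (x v : 'M[R]_(p, n))
    (W : {linear 'M[R]_(p, n) -> 'M[R]_(p, n)}) : Prop :=
  exists E, normal_extension x v E /\
    forall u, tangent x u -> W u = - tproj x ('D_u E x).

Variable mu : multipliers R n m.
Local Notation sigma := (msigma mu).

Definition opT (X : symmx R n) : symmx R n :=
  sigma^-1 *: prox (fun V => (sigma%:E * conjugate (ph P) V)%E)
                   (sigma *: X - mZ mu).

(* The argument of [ph P] is a value of the proximal operator of [ph P / sigma]
   (Moreau decomposition), where [ph P] is finite. *)
Definition Phi (X : symmx R n) : R :=
  pf P X + fine (ph P (X - sigma^-1 *: mZ mu - opT X))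
  + sigma / 2 * (fnorm (opA (pA P) X - pb P - sigma^-1 *: my mu) ^+ 2
                 + `|opT X| ^+ 2).

Definition Psi {p : nat} (x : 'M[R]_(p, n)) : R := Phi (gram x).

Definition rgrad {p : nat} (x : 'M[R]_(p, n)) : 'M[R]_(p, n) :=
  tproj x (mgrad Psi x).

Definition hessPhi (Theta : symmx R n -> symmx R n) (X S : symmx R n) :
    symmx R n :=
  'd (sgrad (pf P)) X S
  + sigma *: opA_adj (pA P) (opA (pA P) S) + sigma *: Theta S.

Definition hessPsi {p : nat} (Theta : symmx R n -> symmx R n)
    (x u : 'M[R]_(p, n)) : 'M[R]_(p, n) :=
  2 *: (u *m sgrad Phi (gram x))
  + 2 *: (x *m hessPhi Theta (gram x) (dgram x u)).

(* An operator on [tangent x] is represented by any linear operator on the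
   ambient space extending it. *)
Definition rhess {p : nat} (x : 'M[R]_(p, n)) :
    set {linear 'M[R]_(p, n) -> 'M[R]_(p, n)} :=
  [set H | exists Theta W, [/\ clarke opT (gram x) Theta,
     weingarten x (nproj x (mgrad Psi x)) W &
     forall u, tangent x u -> H u = tproj x (hessPsi Theta x u) + W u]].

End Problem.

(** * The regularized Riemannian semismooth Newton method *)

Record parameters (R : realType) := MkParams {
  eta1 : R; eta2 : R;
  gamma0 : R; gamma1 : R; gamma2 : R;
  nu_min : R; theta : R; armijo : R;
}.

Definition valid_parameters {R : realType} (par : parameters R) : Prop :=
  [/\ 0 < eta1 par, eta1 par <= eta2 par & eta2 par < 1] /\
  [/\ 0 < gamma0 par, gamma0 par < 1, 1 < gamma1 par
    & gamma1 par <= gamma2 par] /\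
  [/\ 0 < nu_min par, 0 <= theta par & 0 < armijo par].

Section Method.
Context {R : realType} {n m m0 p : nat}.
Variables (P : problem R n m m0) (mu : multipliers R n m).
Variables (r : 'M[R]_(p, n) -> 'M[R]_(p, n) -> 'M[R]_(p, n)).
Variable par : parameters R.
Implicit Types (H : {linear 'M[R]_(p, n) -> 'M[R]_(p, n)}).
Implicit Types (x u : 'M[R]_(p, n)) (nu : R).

Definition model x H nu u : R :=
  fdot (rgrad P mu x) u + 2^-1 * fdot (H u) u + nu / 2 * fnorm u ^+ 2.

(* [g] is the gradient at [u] of the model as a function on [tangent P x] *)
Definition model_gradient x H nu u (g : 'M[R]_(p, n)) : Prop :=
  tangent P x g /\
  forall v, tangent P x v -> is_derive u v (model x H nu) (fdot g v).

Definition rho x H nu u : R :=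
  (Psi P mu (r x u) - Psi P mu x) / (model x H nu u - nu / 2 * fnorm u ^+ 2).

Definition admissible_step x H nu u : Prop :=
  tangent P x u /\
  [/\ (exists2 g, model_gradient x H nu u g &
         fnorm g <= theta par * fnorm u),
      model x H nu u <= 0,
      fdot u (rgrad P mu x) < 0 &
      model x H nu u <= armijo par * fdot (rgrad P mu x) u].

Definition iteration x H nu u x' nu' : Prop :=
  [/\ rhess P mu x H, admissible_step x H nu u,
      x' = (if eta1 par <= rho x H nu u then r x u else x) &
      [/\ eta2 par <= rho x H nu u ->
            Num.max (nu_min par) (gamma0 par * nu) <= nu' <= nu,
          eta1 par <= rho x H nu u < eta2 par ->
            nu <= nu' <= gamma1 par * nu &
          rho x H nu u < eta1 par ->
            gamma1 par * nu <= nu' <= gamma2 par * nu]].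

(* No admissible step exists at a zero of the Riemannian gradient: a run that
   reaches one stops there, and is continued by constant sequences. *)
Definition run (x_ : nat -> 'M[R]_(p, n))
    (H_ : nat -> {linear 'M[R]_(p, n) -> 'M[R]_(p, n)})
    (nu_ : nat -> R) (u_ : nat -> 'M[R]_(p, n)) : Prop :=
  forall l : nat,
    (rgrad P mu (x_ l) <> 0 ->
       iteration (x_ l) (H_ l) (nu_ l) (u_ l) (x_ l.+1) (nu_ l.+1)) /\
    (rgrad P mu (x_ l) = 0 -> x_ l.+1 = x_ l /\ nu_ l.+1 = nu_ l).

Definition successful_above (x_ : nat -> 'M[R]_(p, n))
    (H_ : nat -> {linear 'M[R]_(p, n) -> 'M[R]_(p, n)})
    (nu_ : nat -> R) (u_ : nat -> 'M[R]_(p, n)) (eps : R) : set nat :=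
  [set l | eta1 par <= rho (x_ l) (H_ l) (nu_ l) (u_ l) /\
           eps < fnorm (rgrad P mu (x_ l))].

End Method.

(* Main.v *)
(* Testing the inexact stationarity of the model in the direction of the
   Riemannian gradient itself gives
   |grad Psi(R_l)| <= (theta + nu_l + kappa_H) |U_l| at the current iterate,
   while a successful step decreases Psi by at least eta1 nu_l |U_l|^2 / 2.
   As nu_l stays between two positive bounds, every successful iteration with
   |grad Psi(R_l)| > eps costs a fixed amount of the budget
   Psi(R_0) - Psi_low. Unsuccessful iterations leave R_l unchanged and cannot
   go on forever, so convergence along successful iterations is convergence of
   the whole sequence. *)

Require Import Defs.
From HB Require Import structures.
From mathcomp Require Import all_boot all_order all_algebra finmap.
From mathcomp Require Import all_classical all_reals all_analysis.
From mathcomp Require Import ring lra.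

Set Implicit Arguments.
Unset Strict Implicit.
Unset Printing Implicit Defensive.

Import Order.TTheory GRing.Theory Num.Theory.
Import numFieldNormedType.Exports.

Local Open Scope classical_set_scope.
Local Open Scope ring_scope.

(** * Further properties of the Frobenius product *)

Lemma fdotNl (R : realType) (p n : nat) (A B : 'M[R]_(p, n)) :
  fdot (- A) B = - fdot A B.
Proof. by rewrite -scaleN1r fdotZl mulN1r. Qed.

Lemma fdot0r (R : realType) (p n : nat) (A : 'M[R]_(p, n)) :
  fdot A 0 = 0.
Proof. by rewrite fdotC fdot0l. Qed.

Lemma fnorm0 (R : realType) (p n : nat) : fnorm (0 : 'M[R]_(p, n)) = 0.
Proof. by rewrite /fnorm fdot0l sqrtr0. Qed.

Lemma fnorm_gt0 (R : realType) (p n : nat) (A : 'M[R]_(p, n)) :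
  A != 0 -> 0 < fnorm A.
Proof.
move=> A0; rewrite lt_neqAle fnorm_ge0 andbT eq_sym.
by apply: contra_neq A0 => /fnorm_eq0.
Qed.

Lemma fdot_abs_le (R : realType) (p n : nat) (A B : 'M[R]_(p, n)) :
  `|fdot A B| <= fnorm A * fnorm B.
Proof.
rewrite ler_norml fdot_le andbT lerNl -fdotNl.
apply: le_trans (fdot_le _ _) _.
by rewrite -scaleN1r fnormZ normrN1 mul1r.
Qed.

(** By symmetry of [B] both halves of the trace agree. [2 *: (x *m B)] is the gradient of the
    constraint [\tr (B *m gram x)], so tangency becomes orthogonality to such gradients. *)
Lemma fdot_dgramE (R : realType) (p n : nat) (B : symmx R n)
    (x u : 'M[R]_(p, n)) :
  \tr (B *m dgram x u) = fdot (2 *: (x *m B)) u.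
Proof.
have /eqP BT : (B : 'M[R]_n)^T == B := symmxP B.
rewrite /= mulmxDr mxtraceD fdotZl /fdot trmx_mul BT mulmxA.
rewrite -[\tr (B *m (u^T *m x))]mxtrace_tr !trmx_mul trmxK BT.
rewrite mxtrace_mulC mulmxA -(mulmxA x^T) [\tr (x^T *m _)]mxtrace_mulC.
by rewrite mulr_natl mulr2n.
Qed.

(** * Tangent spaces *)

Section TangentSpace.
Context {R : realType} {n m m0 p : nat} (P : problem R n m m0).
Implicit Types x u v w : 'M[R]_(p, n).

Lemma tangentP x u :
  tangent P x u <-> forall i, fdot (2 *: (x *m pB P i)) u = 0.
Proof.
split=> [xu i|xu].
  by have /matrixP/(_ i 0) := xu; rewrite !mxE fdot_dgramE.
by apply/matrixP => i j; rewrite !mxE fdot_dgramE.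
Qed.

Lemma tangentZ x k u : tangent P x u -> tangent P x (k *: u).
Proof.
by move=> /tangentP xu; apply/tangentP => i; rewrite fdotZr xu mulr0.
Qed.

Lemma tproj_tangent x v : tangent P x (tproj P x v).
Proof.
rewrite /tproj; case: xgetP => [w _ []//|_].
(* The default value 0 of [xget] is tangent as well. *)
by apply/tangentP => i; rewrite fdot0r.
Qed.

End TangentSpace.

(** * Derivatives of quadratics, and counting by telescoping *)

Lemma is_derive_quadratic (R : realType) (V : normedModType R) (f : V -> R)
    (x v : V) (a b d : R) :
  (forall h, f (h *: v + x) = f x + h * a + h ^+ 2 * b) ->
  is_derive x v f d -> d = a.
Proof.
move=> fE [fxv <-].
suff: h^-1 *: ((f \o shift x) (h *: v) - f x) @[h --> 0^'] --> a.
  exact: cvg_lim.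
apply: (@cvg_trans _ ((fun h => a + h * b) @ 0^')).
  apply: near_eq_cvg; near=> h.
  have h0 : h != 0 by near: h; exact: nbhs_dnbhs_neq.
  by rewrite /= fE /GRing.scale/=; field.
have -> : nbhs a = nbhs (a + 0 * b) by rewrite mul0r addr0.
apply: cvgD; first exact: cvg_cst.
by apply: cvgMl; exact: nbhs_dnbhs.
Unshelve. all: by end_near. Qed.

(** All drops of [a] together telescope to at most [a 0 - low], and each index in [S] consumes at
    least [d]. Used for [Psi] along the run and for the negated [nu] on a tail. *)
Lemma decrease_count (R : realType) (a : nat -> R) (low d : R) (S : set nat) :
  0 < d -> (forall l, a l.+1 <= a l) -> (forall l, low <= a l) ->
  (forall l, S l -> d <= a l - a l.+1) ->
  finite_set S /\ (#|` fset_set S|)%:R * d <= a 0%N - low.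
Proof.
move=> d_gt0 a_dec a_low aS.
have count_le k : (count (mem S) (iota 0 k))%:R * d <= a 0%N - a k.
  elim: k => [|k IHk]; first by rewrite mul0r subrr.
  rewrite -addn1 iotaD count_cat natrD mulrDl/= addn0 add0n addn1.
  have -> : a 0%N - a k.+1 = (a 0%N - a k) + (a k - a k.+1) by ring.
  apply: lerD => //; case: (boolP (k \in S)) => [/set_mem/aS|_] /=.
    by rewrite mul1r.
  by rewrite mul0r subr_ge0.
(* A finite subset of [S] sits inside the initial segment ending at its maximum. *)
have card_le (F : {fset nat}) : [set` F] `<=` S -> #|` F|%:R * d <= a 0%N - low.
  move=> FS; pose k := (\max_(i <- F) i).+1.
  apply: (@le_trans _ _ (a 0%N - a k)); last by rewrite lerD2l lerN2.
  apply: le_trans (count_le k); rewrite ler_pM2r// ler_nat -size_filter.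
  apply: uniq_leq_size; first exact: fset_uniq.
  move=> i iF; rewrite mem_filter mem_iota/= add0n ltnS.
  apply/andP; split; first by apply/mem_set/FS.
  exact: leq_bigmax_seq.
have finS : finite_set S.
  apply: contrapT => infS.
  have [F FS] := infinite_set_fset (Num.bound ((a 0%N - low) / d)) infS.
  rewrite leqNgt => /negP; apply.
  rewrite -(ltr_nat R); apply: le_lt_trans (archi_boundP _).
    by rewrite ler_pdivlMr// card_le.
  by rewrite divr_ge0 ?subr_ge0// ltW.
by split=> //; apply: card_le => i; rewrite fset_setK.
Qed.

(** * Estimates for a single step *)

Section NewtonStep.
Context {R : realType} {n m m0 p : nat} (P : problem R n m m0).
Context (mu : multipliers R n m).
Context (r : 'M[R]_(p, n) -> 'M[R]_(p, n) -> 'M[R]_(p, n)).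
Context (par : parameters R).
Implicit Types (H : {linear 'M[R]_(p, n) -> 'M[R]_(p, n)}).
Implicit Types (x u v : 'M[R]_(p, n)) (nu : R).

(** [H] is not assumed self-adjoint, so both cross terms survive. *)
Lemma is_derive_model x H nu u v d :
  is_derive u v (model P mu x H nu) d ->
  d = fdot (rgrad P mu x) v + 2^-1 * (fdot (H u) v + fdot (H v) u)
      + nu * fdot u v.
Proof.
apply: (@is_derive_quadratic _ _ _ _ _ _
  (2^-1 * fdot (H v) v + nu / 2 * fnorm v ^+ 2)) => h.
rewrite /model linearP !sqr_fnorm !(fdotDl, fdotDr, fdotZl, fdotZr).
by rewrite (fdotC v u); field.
Qed.

(* The gradient of the model involves the symmetric part of [H], whose operator
   norm is at most that of [H]. *)
Lemma rgrad_le_step x H nu u kappa : 0 <= nu ->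
  (forall v, tangent P x v -> fnorm (H v) <= kappa * fnorm v) ->
  admissible_step P mu par x H nu u ->
  fnorm (rgrad P mu x) <= (theta par + nu + kappa) * fnorm u.
Proof.
move=> nu0 Hle [xu [[g [xg gP] gle] _ _ _]].
set G := rgrad P mu x.
have xG : tangent P x G by exact: tproj_tangent.
have [->|G0] := eqVneq G 0.
  (* [theta * |u|] and [kappa * |u|] bound norms, hence are nonnegative. *)
  rewrite fnorm0.
  have := Hle u xu; have := fnorm_ge0 (H u); have := fnorm_ge0 g.
  have := fnorm_ge0 u; nra.
have := is_derive_model (gP _ xG); rewrite -/G -[fdot G G]sqr_fnorm => eqg.
have G_gt0 := fnorm_gt0 G0; rewrite -(ler_pM2r G_gt0).
have h1 := fdot_le g G.
have := fdot_abs_le (H u) G; rewrite ler_norml => /andP[h2 _].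
have := fdot_abs_le (H G) u; rewrite ler_norml => /andP[h3 _].
have := fdot_abs_le u G; rewrite ler_norml => /andP[h4 _].
have h5 := Hle _ xu; have h6 := Hle _ xG.
have u_ge0 := fnorm_ge0 u.
have h1' : fdot g G <= theta par * fnorm u * fnorm G.
  by apply: le_trans h1 _; rewrite ler_pM2r.
have h2' : - (kappa * fnorm u * fnorm G) <= fdot (H u) G.
  by apply: le_trans h2; rewrite lerN2 ler_pM2r.
have h3' : - (kappa * fnorm G * fnorm u) <= fdot (H G) u.
  by apply: le_trans h3; rewrite lerN2 ler_wpM2r.
have h4' : - (nu * (fnorm u * fnorm G)) <= nu * fdot u G.
  by rewrite -mulrN ler_wpM2l.
nra.
Qed.

Lemma admissible_step_gt0 x H nu u :
  admissible_step P mu par x H nu u -> 0 < fnorm u.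
Proof.
move=> [_ [_ _ uG _]]; apply: fnorm_gt0; apply: contraTneq uG => ->.
by rewrite fdot0l ltxx.
Qed.

(** As the model value is at most 0, the denominator of [rho] is at most [- nu / 2 * |u|^2 < 0];
    clearing it reverses the test [eta1 <= rho]. *)
Lemma admissible_step_decrease x H nu u : 0 < nu ->
  admissible_step P mu par x H nu u -> 0 < eta1 par ->
  eta1 par <= rho P mu r x H nu u ->
  eta1 par * nu / 2 * fnorm u ^+ 2 <= Psi P mu x - Psi P mu (r x u).
Proof.
move=> nu0 xu eta0; have u0 := admissible_step_gt0 xu.
have [_ [_ mle _ _]] := xu.
have nu_u : 0 < nu / 2 * fnorm u ^+ 2 by rewrite mulr_gt0 ?exprn_gt0 ?divr_gt0.
rewrite /rho; set q := model _ _ _ _ _ _ - _ => h.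
have q_le : q <= - (nu / 2 * fnorm u ^+ 2) by rewrite lerBlDr addNr.
have q_lt0 : q < 0 by apply: le_lt_trans q_le _; rewrite oppr_lt0.
have qM : eta1 par * (nu / 2 * fnorm u ^+ 2) <= eta1 par * - q.
  by rewrite ler_pM2l// lerNr.
rewrite ler_ndivlMr// in h.
apply: (@le_trans _ _ (eta1 par * - q)); first by rewrite -!mulrA in qM *.
by rewrite mulrN lerNl opprB.
Qed.

(* Once [nu] dominates [Lbar + kappa], the model overestimates [Psi] enough
   for the step to be very successful. *)
Lemma regularization_lt x H nu u Lbar kappa : 0 < nu ->
  admissible_step P mu par x H nu u ->
  fnorm (H u) <= kappa * fnorm u ->
  Psi P mu (r x u) <=
    Psi P mu x + fdot (rgrad P mu x) u + Lbar / 2 * fnorm u ^+ 2 ->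
  eta2 par < 1 -> rho P mu r x H nu u < eta2 par ->
  nu < (Lbar + kappa) / (1 - eta2 par).
Proof.
move=> nu0 xu Hle PsiLe eta2_lt1; have u0 := admissible_step_gt0 xu.
have [_ [_ mle _ _]] := xu.
have nu_u : 0 < nu / 2 * fnorm u ^+ 2 by rewrite mulr_gt0 ?exprn_gt0 ?divr_gt0.
rewrite /rho; set q := model _ _ _ _ _ _ - _ => h.
have q_le : q <= - (nu / 2 * fnorm u ^+ 2) by rewrite lerBlDr addNr.
have q_lt0 : q < 0 by apply: le_lt_trans q_le _; rewrite oppr_lt0.
have qE : q = fdot (rgrad P mu x) u + 2^-1 * fdot (H u) u.
  by rewrite /q /model addrK.
rewrite ltr_ndivrMr// in h.
have := fdot_abs_le (H u) u; rewrite ler_norml => /andP[Hu _].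
have Hu' : - (kappa * fnorm u ^+ 2) <= fdot (H u) u.
  by apply: le_trans Hu; rewrite lerN2 expr2 mulrA ler_pM2r.
(* The failed test gives [eta2 * q < Psi (r x u) - Psi x <= q + (Lbar + kappa) / 2 * |u|^2];
   isolating [(1 - eta2) * - q] and using [- q >= nu / 2 * |u|^2] bounds [nu]. *)
have q_le' : (1 - eta2 par) * q <= (1 - eta2 par) * - (nu / 2 * fnorm u ^+ 2).
  by rewrite ler_pM2l// subr_gt0.
rewrite ltr_pdivlMr ?subr_gt0//.
rewrite -(@ltr_pM2r _ (fnorm u ^+ 2)) ?exprn_gt0//.
clearbody q; move: PsiLe h qE Hu' q_le'.
move: (Psi P mu _) (Psi P mu _) (fdot _ _) (fdot _ _) (fnorm u).
move: (eta2 par); clear => e2 Psi' Psi0 gu Hu t; lra.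
Qed.

End NewtonStep.

(** * Bounds along a whole run *)

Section Run.
Context {R : realType} {n m m0 p : nat} (P : problem R n m m0).
Context (mu : multipliers R n m).
Context (r : 'M[R]_(p, n) -> 'M[R]_(p, n) -> 'M[R]_(p, n)).
Context (par : parameters R) (Psi_low kappa Lbar : R).
Context (x_ : nat -> 'M[R]_(p, n)).
Context (H_ : nat -> {linear 'M[R]_(p, n) -> 'M[R]_(p, n)}).
Context (nu_ : nat -> R) (u_ : nat -> 'M[R]_(p, n)).
Context (par_valid : valid_parameters par).
Context (Psi_lowP : forall x : 'M[R]_(p, n), setM P x ->
  Psi_low <= Psi P mu x).
Context (r_setM : forall x u, setM P x -> tangent P x u -> setM P (r x u)).
Context (hess_le : forall x u : 'M[R]_(p, n), setM P x -> tangent P x u ->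
  forall H, rhess P mu x H -> fnorm (H u) <= kappa * fnorm u).
Context (Psi_retr_le : forall x u : 'M[R]_(p, n),
  setM P x -> tangent P x u ->
  Psi P mu (r x u) <=
    Psi P mu x + fdot (rgrad P mu x) u + Lbar / 2 * fnorm u ^+ 2).
Context (x0_in : setM P (x_ 0%N)).
Context (x_run : run P mu r par x_ H_ nu_ u_).

Let nu_max := gamma2 par * (Lbar + kappa) / (1 - eta2 par).

Lemma run_in l : setM P (x_ l).
Proof.
elim: l => // l xl; have [it stop] := x_run l.
have [/stop[-> //]|/eqP/it[_ [xu _] -> _]] := eqVneq (rgrad P mu (x_ l)) 0.
by case: ifP => // _; exact: r_setM.
Qed.

(** [nu] can grow only if [rho < eta2]; then it lies below [nu_max / gamma2], and its growth factor
    is at most [gamma2]. General [c] and [V] also allow an initial value outside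
    [[nu_min, nu_max]]. *)
Lemma run_nu_bounds c V l : 0 < c -> c <= nu_min par -> nu_max <= V ->
  c <= nu_ 0%N <= V -> c <= nu_ l <= V.
Proof.
move=> c_gt0 c_le V_ge nu0; elim: l => // l /andP[cl lV].
have [[_ _ eta2_lt1] [[_ _ gt1 g12] _]] := par_valid.
have [it stop] := x_run l.
have [/stop[_ ->]|/eqP/it[Hl xu _ [vs s us]]] := eqVneq (rgrad P mu (x_ l)) 0.
  by rewrite cl.
have nul : 0 < nu_ l by exact: lt_le_trans cl.
case: (leP (eta2 par) (rho P mu r (x_ l) (H_ l) (nu_ l) (u_ l))) => [/vs|lt2].
  rewrite ge_max => /andP[/andP[h1 h2] h3].
  by rewrite (le_trans c_le h1) (le_trans h3 lV).
have := regularization_lt nul xu (hess_le (run_in l) xu.1 Hl)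
  (Psi_retr_le (run_in l) xu.1) eta2_lt1 lt2.
set K := _ / _ => nuK.
have KV : gamma2 par * K <= V by rewrite mulrA.
case: (leP (eta1 par) (rho P mu r (x_ l) (H_ l) (nu_ l) (u_ l))) => [ge1|/us].
  have := s; rewrite ge1 lt2 => /(_ isT) /andP[h1 h2].
  rewrite (le_trans cl h1) (le_trans h2)//; nra.
move=> /andP[h1 h2]; apply/andP; split; first nra.
by apply: le_trans h2 _; nra.
Qed.

Lemma run_decrease l : 0 < nu_ l -> Psi P mu (x_ l.+1) <= Psi P mu (x_ l).
Proof.
move=> nul; have [it stop] := x_run l.
have [[eta1_gt0 _ _] _] := par_valid.
have [/stop[-> _]|/eqP/it[_ xu -> _]] := eqVneq (rgrad P mu (x_ l)) 0.
  exact: lexx.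
case: ifP => [ge1|_]; last exact: lexx.
rewrite -subr_ge0.
apply: le_trans (admissible_step_decrease nul xu eta1_gt0 ge1).
by rewrite mulr_ge0 ?sqr_ge0// divr_ge0// mulr_ge0 ?ltW.
Qed.

(** The gradient bound forces a step longer than [eps / (theta + V + kappa)]. The same chain shows
    this denominator to be positive, [kappa] having no prescribed sign. *)
Lemma successful_above_decrease c V eps l : 0 < c -> c <= nu_ l <= V ->
  0 < eps -> successful_above P mu r par x_ H_ nu_ u_ eps l ->
  0 < theta par + V + kappa /\
  eta1 par * c / 2 * (eps / (theta par + V + kappa)) ^+ 2
    <= Psi P mu (x_ l) - Psi P mu (x_ l.+1).
Proof.
move=> c_gt0 /andP[cl lV] eps_gt0 [ge1 eps_lt]; have [it _] := x_run l.
have [[eta1_gt0 _ _] _] := par_valid.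
have nul : 0 < nu_ l by exact: lt_le_trans cl.
have [|Hl xu -> _] := it.
  by apply/eqP; apply: contraTneq eps_lt => ->; rewrite fnorm0 -leNgt ltW.
have u_gt0 := admissible_step_gt0 xu.
have le_step := rgrad_le_step (ltW nul)
  (fun v xv => hess_le (run_in l) xv Hl) xu.
have lt_step : eps < (theta par + V + kappa) * fnorm (u_ l).
  apply: (lt_le_trans eps_lt); apply: le_trans le_step _.
  by rewrite ler_pM2r//; lra.
have N_gt0 : 0 < theta par + V + kappa.
  by rewrite -(pmulr_lgt0 _ u_gt0); exact: lt_trans lt_step.
split=> //; rewrite ge1.
apply: le_trans (admissible_step_decrease nul xu eta1_gt0 ge1).
apply: ler_pM.
- by rewrite divr_ge0// mulr_ge0 ?ltW.
- by rewrite sqr_ge0.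
- by rewrite ler_pM2r// ler_pM2l.
- rewrite ler_pXn2r ?nnegrE ?fnorm_ge0 ?divr_ge0 ?ltW//.
  by rewrite ltr_pdivrMr// mulrC.
Qed.

(** Positivity of the constant is extracted from an element of [S], hence the condition that [S] be
    nonempty. *)
Lemma run_successful_count c V eps : 0 < c -> c <= nu_min par -> nu_max <= V ->
  c <= nu_ 0%N <= V -> 0 < eps ->
  let S := successful_above P mu r par x_ H_ nu_ u_ eps in
  finite_set S /\
  (S !=set0 -> 0 < theta par + V + kappa /\
   (#|` fset_set S|)%:R * (eta1 par * c / 2 * (eps / (theta par + V + kappa)) ^+ 2)
     <= Psi P mu (x_ 0%N) - Psi_low).
Proof.
move=> c_gt0 c_le V_ge nu0 eps_gt0 S.
have nuP l : c <= nu_ l <= V by exact: run_nu_bounds.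
have SP l (Sl : S l) := successful_above_decrease c_gt0 (nuP l) eps_gt0 Sl.
have [[eta1_gt0 _ _] _] := par_valid.
have [->|/set0P[l Sl]] := eqVneq S set0.
  by split; [exact: finite_set0 | case].
have [N_gt0 _] := SP _ Sl.
have d_gt0 : 0 < eta1 par * c / 2 * (eps / (theta par + V + kappa)) ^+ 2.
  by rewrite mulr_gt0 ?exprn_gt0 ?divr_gt0// mulr_gt0.
have [||k /SP[]|finS cardS] :=
  @decrease_count _ (fun k => Psi P mu (x_ k)) Psi_low _ S d_gt0.
- move=> k; apply: run_decrease; have /andP[ck _] := nuP k.
  exact: lt_le_trans ck.
- by move=> k; apply/Psi_lowP/run_in.
- by [].
- by split.
Qed.

(* Unsuccessful iterations do not move the iterate and multiply [nu] by at least
   [gamma1 > 1], so boundedness of [nu] rules out an infinite tail of them. *)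
Lemma run_next_successful c V l : 0 < c -> c <= nu_min par -> nu_max <= V ->
  c <= nu_ 0%N <= V ->
  exists2 k, (l <= k)%N & x_ k = x_ l /\ (rgrad P mu (x_ k) = 0 \/
    eta1 par <= rho P mu r (x_ k) (H_ k) (nu_ k) (u_ k)).
Proof.
move=> c_gt0 c_le V_ge nu0; apply: contrapT => noex.
have nuP k : c <= nu_ k <= V by exact: run_nu_bounds.
have [_ [[_ _ gt1 _] _]] := par_valid.
have stuck k : (l <= k)%N -> x_ k = x_ l ->
    x_ k.+1 = x_ l /\ gamma1 par * nu_ k <= nu_ k.+1.
  move=> lk xk; have [it _] := x_run k.
  have [|_ _ -> [_ _ us]] := it.
    by move=> gk; apply: noex; exists k => //; split=> //; left.
  have : rho P mu r (x_ k) (H_ k) (nu_ k) (u_ k) < eta1 par.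
    rewrite ltNge; apply/negP => ge1.
    by apply: noex; exists k => //; split=> //; right.
  by move=> lt1; have /andP[h _] := us lt1; rewrite leNgt lt1.
have tail k : x_ (l + k)%N = x_ l.
  elim: k => [|k IHk]; first by rewrite addn0.
  by rewrite addnS; have [] := stuck _ (leq_addr k l) IHk.
(* Each step of the tail lowers [a] by at least [(gamma1 - 1) * c], yet [a >= - V]; counting all
   indices would make [nat] finite. *)
pose a k := - nu_ (l + k)%N.
have grow k : (gamma1 par - 1) * c <= a k - a k.+1.
  have [_ h] := stuck _ (leq_addr k l) (tail k).
  have /andP[h' _] := nuP (l + k)%N.
  by rewrite /a addnS; nra.
have d_gt0 : 0 < (gamma1 par - 1) * c by rewrite mulr_gt0 ?subr_gt0.
have [|k|//|+ _] := @decrease_count _ a (- V) _ [set: nat] d_gt0.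
- by move=> k; rewrite -subr_ge0; apply: le_trans (grow k); exact: ltW.
- by rewrite lerN2; have /andP[] := nuP (l + k)%N.
- exact: infinite_nat.
Qed.

Lemma run_rgrad_cvg0 : 0 < nu_ 0%N ->
  (fun l => fnorm (rgrad P mu (x_ l))) @ \oo --> (0 : R).
Proof.
move=> nu0_gt0; have [_ [_ [nu_min_gt0 _ _]]] := par_valid.
(* The limit is claimed for every positive initial [nu], so the bounds are widened to contain it. *)
pose c := Num.min (nu_ 0%N) (nu_min par); pose V := Num.max (nu_ 0%N) nu_max.
have c_gt0 : 0 < c by rewrite lt_min nu0_gt0.
have c_le : c <= nu_min par by rewrite ge_min lexx orbT.
have V_ge : nu_max <= V by rewrite le_max lexx orbT.
have nu0 : c <= nu_ 0%N <= V by rewrite ge_min le_max !lexx.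
apply/cvgrPdist_le => eps eps_gt0.
have [finS _] := run_successful_count c_gt0 c_le V_ge nu0 eps_gt0.
set S := successful_above _ _ _ _ _ _ _ _ _ in finS.
(* Beyond the last element of [S], the next successful index [k >= l] has the same iterate and is
   not in [S], so its gradient norm is at most [eps]. *)
exists (\max_(i <- fset_set S) i).+1 => // l /= lS.
rewrite sub0r normrN ger0_norm ?fnorm_ge0//.
have [k lk [<- [->|ge1]]] := run_next_successful l c_gt0 c_le V_ge nu0.
  by rewrite fnorm0 ltW.
rewrite leNgt; apply/negP => gt_eps.
have Sk : k \in fset_set S by rewrite in_fset_set//; apply/mem_set; split.
have := leq_trans lS lk; rewrite ltnNge => /negP; apply.
exact: leq_bigmax_seq.
Qed.

End Run.

(* A retraction moves every point with a nonzero tangent vector, so the manifold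
   has two distinct points there and a Lipschitz constant cannot be negative. *)
Lemma lipschitz_const_ge0 (R : realType) (n m m0 p : nat)
    (P : problem R n m m0) (r : 'M[R]_(p, n) -> 'M[R]_(p, n) -> 'M[R]_(p, n))
    (beta : R) (F : 'M[R]_(p, n) -> 'M[R]_(p, n)) (L : R)
    (x u : 'M[R]_(p, n)) :
  (forall x u, setM P x -> tangent P x u -> setM P (r x u)) ->
  0 < beta ->
  (forall x u, setM P x -> tangent P x u ->
     fnorm (r x u - x - u) <= beta * fnorm u ^+ 2) ->
  (forall x w, setM P x -> setM P w ->
     fnorm (F x - F w) <= L * fnorm (x - w)) ->
  setM P x -> tangent P x u -> 0 < fnorm u -> 0 <= L.
Proof.
move=> r_setM beta_gt0 r_le FL xM xu u_gt0.
have b_gt0 : 0 < 2 * beta * fnorm u by rewrite !mulr_gt0.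
(* This [t] gives [beta * |t u|^2 = |t u| / 2], so a retraction fixing [x] would yield
   [|t u| <= |t u| / 2]. *)
pose t := (2 * beta * fnorm u)^-1.
have t_gt0 : 0 < t by rewrite invr_gt0.
have xtu : tangent P x (t *: u) by exact: tangentZ.
have [rx|rx] := eqVneq (x - r x (t *: u)) 0.
  have := r_le _ _ xM xtu.
  rewrite -(subr0_eq rx) subrr sub0r -scaleNr !fnormZ normrN gtr0_norm//.
  have -> : beta * (t * fnorm u) ^+ 2 = t * fnorm u / 2.
    by rewrite /t; field; rewrite !gt_eqF.
  have := mulr_gt0 t_gt0 u_gt0; lra.
have := le_trans (fnorm_ge0 _) (FL _ _ xM (r_setM _ _ xM xtu)).
by rewrite pmulr_lge0// fnorm_gt0.
Qed.

(** * Complexity bound and convergence *)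

Theorem theorem3p7 (R : realType) (n m m0 p : nat)
  (P : problem R n m m0) (mu : multipliers R n m)
  (p_gt0 : (0 < p)%N)
  (sigma_gt0 : 0 < msigma mu)
  (A1 : problem_assumption P)
  (A2 : manifold_assumption P p)
  (Phi_C1 : (forall X, differentiable (Phi P mu) X) /\
            continuous (sgrad (Phi P mu)))
  (Psi_low : R)
  (Psi_lowP : forall x : 'M[R]_(p, n), setM P x -> Psi_low <= Psi P mu x)
  (r : 'M[R]_(p, n) -> 'M[R]_(p, n) -> 'M[R]_(p, n))
  (r_retraction : retraction P r)
  (kappa_Psi kappa_H : R)
  (B1_grad : forall x : 'M[R]_(p, n), setM P x ->
     fnorm (mgrad (Psi P mu) x) <= kappa_Psi)
  (B1_hess : forall x u : 'M[R]_(p, n), setM P x -> tangent P x u ->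
     forall H, rhess P mu x H -> fnorm (H u) <= kappa_H * fnorm u)
  (alpha beta : R) (alpha_gt0 : 0 < alpha) (beta_gt0 : 0 < beta)
  (B2 : forall x u : 'M[R]_(p, n), setM P x -> tangent P x u ->
     fnorm (r x u - x) <= alpha * fnorm u /\
     fnorm (r x u - x - u) <= beta * fnorm u ^+ 2)
  (M : R) (M_gt0 : 0 < M)
  (B3 : forall x u v : 'M[R]_(p, n), setM P x -> tangent P x u ->
     fnorm (tproj P x v - tproj P (r x u) v) <= M * fnorm v * fnorm u)
  (L_Psi : R)
  (L_PsiP : forall x w : 'M[R]_(p, n), setM P x -> setM P w ->
     fnorm (mgrad (Psi P mu) x - mgrad (Psi P mu) w) <= L_Psi * fnorm (x - w))
  (Lbar_Psi : R)
  (Lbar_PsiP : forall x u : 'M[R]_(p, n), setM P x -> tangent P x u ->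
     Psi P mu (r x u) <=
       Psi P mu x + fdot (rgrad P mu x) u + Lbar_Psi / 2 * fnorm u ^+ 2)
  (par : parameters R) (par_valid : valid_parameters par)
  (x_ : nat -> 'M[R]_(p, n))
  (H_ : nat -> {linear 'M[R]_(p, n) -> 'M[R]_(p, n)})
  (nu_ : nat -> R) (u_ : nat -> 'M[R]_(p, n))
  (x0_in : setM P (x_ 0%N)) (nu0_gt0 : 0 < nu_ 0%N)
  (x_run : run P mu r par x_ H_ nu_ u_) :
  let nu_max := gamma2 par * (Lbar_Psi + kappa_H) / (1 - eta2 par) in
  let N := theta par + nu_max + alpha * L_Psi + alpha * kappa_Psi * M + kappa_H
  in
  (nu_min par <= nu_ 0%N <= nu_max ->
   forall eps : R, 0 < eps ->
     let S := successful_above P mu r par x_ H_ nu_ u_ eps in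
     finite_set S /\
     (#|` fset_set S|)%:R <=
       2 * (Psi P mu (x_ 0%N) - Psi_low) / (eta1 par * nu_min par)
         * N ^+ 2 * (1 / eps ^+ 2)) /\
  (fun l => fnorm (rgrad P mu (x_ l))) @ \oo --> (0 : R).
move=> nu_max N.
have [r_setM _ _ _] := r_retraction.
split; last first.
  exact: (run_rgrad_cvg0 par_valid Psi_lowP r_setM B1_hess Lbar_PsiP x0_in
    x_run).
move=> nu0 eps eps_gt0 S.
have [[eta1_gt0 _ _] [_ [nu_min_gt0 _ _]]] := par_valid.
have [finS] := run_successful_count par_valid Psi_lowP r_setM B1_hess Lbar_PsiP
  x0_in x_run nu_min_gt0 (lexx _) (lexx _) nu0 eps_gt0.
rewrite -/S -/nu_max => cardS; split=> //.
have D_ge0 : 0 <= Psi P mu (x_ 0%N) - Psi_low by rewrite subr_ge0 Psi_lowP.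
have e_gt0 : 0 < eta1 par * nu_min par by rewrite mulr_gt0.
set D := _ - _ in D_ge0 *; set e := _ * _ in e_gt0 *.
have [->|S0] := eqVneq S set0.
  rewrite fset_set0 cardfs0.
  apply: mulr_ge0; last by rewrite divr_ge0 ?sqr_ge0.
  apply: mulr_ge0; last exact: sqr_ge0.
  by apply: divr_ge0; [exact: mulr_ge0 | exact: ltW].
have /set0P Sn := S0; have [l [_ gt_eps]] := Sn.
have [N0_gt0 {}cardS] := cardS Sn.
(* The count holds with [N0], which is [N] without its two [alpha] terms; these are nonnegative, so
   [N0 <= N]. *)
set N0 := theta par + nu_max + kappa_H in N0_gt0 cardS.
have xlM : setM P (x_ l) by exact: (run_in r_setM x0_in x_run).
have [it _] := x_run l; have [|_ xu _ _] := it.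
  apply/eqP; apply: contraTneq gt_eps => ->.
  by rewrite fnorm0 -leNgt ltW.
have L_ge0 : 0 <= L_Psi.
  apply: (lipschitz_const_ge0 r_setM beta_gt0 _ L_PsiP xlM xu.1).
    by move=> x u xM xu'; have [] := B2 x u xM xu'.
  exact: admissible_step_gt0 xu.
have kappa_ge0 : 0 <= kappa_Psi.
  exact: le_trans (fnorm_ge0 _) (B1_grad _ x0_in).
have N0_le : N0 <= N.
  have aL_ge0 : 0 <= alpha * L_Psi by rewrite mulr_ge0// ltW.
  have akM_ge0 : 0 <= alpha * kappa_Psi * M by rewrite !mulr_ge0// ltW.
  by rewrite /N0 /N; lra.
have d_gt0 : 0 < e / 2 * (eps / N0) ^+ 2.
  by rewrite mulr_gt0 ?exprn_gt0 ?divr_gt0.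
rewrite -(ler_pM2r d_gt0); apply: le_trans cardS _.
(* The claimed bound times the cost per iteration is [D * (N / N0)^2], at least the budget [D]. *)
have -> : 2 * D / e * N ^+ 2 * (1 / eps ^+ 2) * (e / 2 * (eps / N0) ^+ 2)
    = D * (N / N0) ^+ 2.
  by field; rewrite !gt_eqF.
rewrite ler_peMr// exprn_ege1//.
by rewrite ler_pdivlMr// mul1r.
Qed.
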